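(* For each commutative unital ring $R$, the topological ring $(R,d)$, where $d$ is the discrete topology, is rigid.
   Context: For a (Hausdorff) topological commutative unital ring $(R,\tau)$ and a set $X$, $(R,\tau)^X$ is the $R$-module $R^X$ of all maps $X\to R$ with the product topology, $R^{(X)}$ is the submodule of finitely supported maps, and $((R,\tau)^X)'$ is the $R$-module of continuous $R$-linear maps $(R,\tau)^X\to(R,\tau)$. $(R,\tau)$ is rigid if for every set $X$ the $R$-linear map $\lambda_X\colon R^{(X)}\to((R,\tau)^X)'$, $\lambda_X(p)(f)=\sum_{x\in X}p(x)f(x)$, is an isomorphism. *)

(* Defs.v *)
From HB Require Import structures.
From mathcomp Require Import all_boot all_algebra finmap.
From mathcomp Require Import all_classical.
From mathcomp Require Import topology tvs.

Set Implicit Arguments.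
Unset Strict Implicit.
Unset Printing Implicit Defensive.

Import GRing.Theory.
Local Open Scope classical_set_scope.
Local Open Scope ring_scope.

(* [comPzRingType], rather than [comNzRingType], so that 1 = 0 is allowed. *)
HB.mixin Record TopologicalZmodule_isTopologicalComRing R
    & TopologicalZmodule R & GRing.ComPzRing R := {
  mul_continuous : continuous (fun x : R * R => x.1 * x.2) ;
  ring_hausdorff : hausdorff_space R
}.

#[short(type="topologicalComRingType")]
HB.structure Definition TopologicalComRing :=
  {R of TopologicalZmodule R & GRing.ComPzRing R
        & TopologicalZmodule_isTopologicalComRing R}.

Section DiscreteRing.
Variable R : comPzRingType.

HB.instance Definition _ :=
  GRing.ComPzRing.copy (discrete_topology R) R.

Let d := discrete_topology R.

Lemma discrete2_continuous (f : d * d -> d) : continuous f.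
Proof.
move=> [x y] A /= fA; exists ([set x], [set y]).
  by split; rewrite nbhs_principalE; apply/principal_filterP.
by move=> [_ _] /= [-> ->]; exact: nbhs_singleton fA.
Qed.

HB.instance Definition _ :=
  PreTopologicalNmodule_isTopologicalZmodule.Build (discrete_topology R)
    (@discrete2_continuous _).

HB.instance Definition _ :=
  TopologicalZmodule_isTopologicalComRing.Build (discrete_topology R)
    (@discrete2_continuous _) (@discrete_hausdorff _).

End DiscreteRing.

Lemma continuous_lincomb (R : topologicalComRingType) (T : topologicalType)
    (a : R) (f g : T -> R) :
  continuous f -> continuous g -> continuous (fun y => a * f y + g y).
Proof.
move=> cf cg y; apply: (@continuous2_cvg _ _ _ _ _ _ (fun z => a * f z) g +%R).
- exact: (@add_continuous R (_, _)).
- apply: (@continuous2_cvg _ _ _ _ _ _ (fun=> a) f *%R).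
  + exact: (@mul_continuous R (_, _)).
  + exact: cvg_cst.
  + exact: cf.
- exact: cg.
Qed.

Section Modules.
Variables (R : topologicalComRingType) (X : Type).

(* [R] is used for the topology and the regular module [R^o], which is
   convertible to it, for the linear structure. *)
Definition power : Type := X -> R.

HB.instance Definition _ := Topological.copy power {ptws X -> R}.
HB.instance Definition _ := GRing.Lmodule.copy power (X -> R^o).

Definition finitely_supported : {pred X -> R^o} :=
  [pred p : X -> R^o | `[< finite_set [set x | p x != 0] >]].

Lemma finitely_supported_submod : submod_closed finitely_supported.
Proof.
split=> [|a p q /asboolP fp /asboolP fq]; apply/asboolP.
  by apply: (@sub_finite_set _ _ set0) => // x /=; rewrite eqxx.
apply: (@sub_finite_set _ _ ([set x | p x != 0] `|` [set x | q x != 0])).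
  move=> x /= nz; have [p0|] := eqVneq (p x) 0; last by left.
  right; move: nz; apply: contraNneq => q0.
  by rewrite (_ : (a *: p + q) x = a *: p x + q x) // p0 q0 scaler0 addr0.
by rewrite finite_setU.
Qed.

HB.instance Definition _ :=
  GRing.isSubmodClosed.Build R (X -> R^o) finitely_supported
    finitely_supported_submod.

Record finsupp : Type := Finsupp {
  finsupp_fun :> X -> R^o ;
  finsuppP : finsupp_fun \in finitely_supported }.

HB.instance Definition _ := [isSub for finsupp_fun].
HB.instance Definition _ := [Choice of finsupp by <:].
HB.instance Definition _ := [SubChoice_isSubLmodule of finsupp by <:].

Definition continuous_linear : {pred power -> R^o} :=
  [pred phi : power -> R^o |
     `[< continuous (phi : power -> R) /\ linear phi >]].

Lemma continuous_linear_submod : submod_closed continuous_linear.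
Proof.
split=> [|a f g /asboolP[cf lf] /asboolP[cg lg]]; apply/asboolP; split.
- exact: (@cst_continuous power R 0).
- by move=> b u v /=; rewrite scaler0 addr0.
- exact: continuous_lincomb.
- move=> b u v /=.
  rewrite !(_ : forall w, (a *: f + g) w = a *: f w + g w) // lf lg.
  by rewrite !scalerDr !scalerA (mulrC a b) addrACA.
Qed.

HB.instance Definition _ :=
  GRing.isSubmodClosed.Build R (power -> R^o) continuous_linear
    continuous_linear_submod.

Record dual : Type := Dual {
  dual_fun :> power -> R^o ;
  dualP : dual_fun \in continuous_linear }.

HB.instance Definition _ := [isSub for dual_fun].
HB.instance Definition _ := [Choice of dual by <:].
HB.instance Definition _ := [SubChoice_isSubLmodule of dual by <:].

(* The library sums over a [choiceType]; [{classic X}] is [X] with the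
   structure provided by the axiom of choice. *)
Definition pairing (p : finsupp) (f : power) : R^o :=
  \sum_(x \in [set: {classic X}]) ((p x : R) * f x).

Lemma pairing_seq (p : finsupp) (s : {fset {classic X}}) :
  (forall x : {classic X}, x \notin s -> p x = 0) ->
  forall f, pairing p f = \sum_(x <- s) (p x : R) * f x.
Proof.
by move=> ps f; rewrite /pairing (fsbigTE s) // => x /ps ->; rewrite mul0r.
Qed.

Lemma finsupp_fset (p : finsupp) :
  exists s : {fset {classic X}}, forall x : {classic X}, x \notin s -> p x = 0.
Proof.
have /asboolP fp := finsuppP p.
have /finite_fsetP[s sE] : finite_set [set x : {classic X} | p x != 0] by [].
exists s => x; apply: contraNeq => nz.
suff : [set` s] x by [].
by rewrite -sE.
Qed.

Lemma pairing_continuous_linear (p : finsupp) : pairing p \in continuous_linear.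
Proof.
have [s ps] := finsupp_fset p; apply/asboolP; split.
  rewrite (_ : pairing p = fun f => \sum_(x <- s) (p x : R) * f x); last first.
    by apply/funext => f; exact: pairing_seq.
  elim: (s : seq _) => [|x r IH].
    rewrite (_ : (fun f => _) = cst 0); first exact: cst_continuous.
    by apply/funext => f; rewrite big_nil.
  rewrite (_ : (fun f => _) =
      fun f : power => (p x : R) * f x + \sum_(y <- r) (p y : R) * f y); last first.
    by apply/funext => f; rewrite big_cons.
  apply: continuous_lincomb => //.
  exact: (@proj_continuous {classic X} (fun=> R) x).
move=> a f g; rewrite !(pairing_seq ps) /GRing.scale /= mulr_sumr -big_split /=.
by apply: eq_bigr => x _; rewrite mulrDr !mulrA (mulrC a).
Qed.

Definition lambda (p : finsupp) : dual := Dual (pairing_continuous_linear p).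

Lemma lambda_linear : linear lambda.
Proof.
move=> a p q; apply/val_inj/funext => f /=.
have [s ps] := finsupp_fset p; have [t qt] := finsupp_fset q.
pose u : {fset {classic X}} := (s `|` t)%fset.
have pu x : x \notin u -> p x = 0 by rewrite in_fsetU negb_or => /andP[/ps].
have qu x : x \notin u -> q x = 0 by rewrite in_fsetU negb_or => /andP[_ /qt].
have pqu x : x \notin u -> (a *: p + q) x = 0.
  by move=> xu; rewrite [LHS](_ : _ = a *: p x + q x) // pu // qu // scaler0 addr0.
rewrite [RHS](_ : _ = a * pairing p f + pairing q f) //.
rewrite (pairing_seq pu) (pairing_seq qu) (pairing_seq pqu) mulr_sumr -big_split /=.
by apply: eq_bigr => x _; rewrite mulrA -mulrDl.
Qed.

HB.instance Definition _ := GRing.isLinear.Build R finsupp dual *:%R lambda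
  lambda_linear.

End Modules.

(* [lambda] is linear, so it is an isomorphism as soon as it is bijective. *)
Definition rigid (R : topologicalComRingType) : Prop :=
  forall X : Type, bijective (@lambda R X).

(* Main.v *)
(* A basic neighbourhood of [0] in [R^X] constrains only a finite set [s] of
   coordinates, and a point is open in [R]; so the kernel of a continuous linear
   form [phi] contains every map vanishing on [s].  Hence [phi f] depends only on
   the restriction of [f] to [s], and [phi] is the image under [lambda] of
   [x |-> phi (delta x)] cut off outside [s]. *)
From HB Require Import structures.
From mathcomp Require Import all_boot all_algebra finmap.
From mathcomp Require Import all_classical.
From mathcomp Require Import topology.
Require Import Defs.

Set Implicit Arguments.
Unset Strict Implicit.
Unset Printing Implicit Defensive.

Import GRing.Theory.
Local Open Scope classical_set_scope.
Local Open Scope ring_scope.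

(** The sets [B s] form a filter base. It converges to [f] because the product topology is the
    supremum of the topologies pulled back along the projections, and a neighbourhood of [f] pulled
    back from coordinate [x] contains [B [fset x]]. *)
Lemma nbhs_ptws_discrete (X : choiceType) (T : discreteTopologicalType)
    (f : {ptws X -> T}) (U : set {ptws X -> T}) :
  nbhs f U -> exists s : {fset X}, forall g, {in s, f =1 g} -> U g.
Proof.
pose B (s : {fset X}) : set {ptws X -> T} := [set g | {in s, f =1 g}].
have FF : Filter (filter_from setT B).
  apply: filter_from_filter; first by exists fset0.
  move=> s t _ _; exists (s `|` t)%fset => // g fg.
  by split=> x xs; apply: fg; rewrite in_fsetU xs ?orbT.
suff /[apply] : filter_from setT B --> f by move=> [s _ sU]; exists s.
apply/cvg_sup => x V [_] [[W] oW <-] Wfx WV.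
exists [fset x]%fset => // g fg; apply: WV.
by rewrite /= -fg // in_fset1.
Qed.

Section Delta.
Variables (R : topologicalComRingType) (X : Type).

Definition delta (x : {classic X}) : power R X :=
  fun y : {classic X} => (y == x)%:R.

Lemma pairing_delta (p : finsupp R X) (x : {classic X}) :
  pairing p (delta x) = p x.
Proof.
have [s ps] := finsupp_fset p.
(* Adjoining [x] lets its term be split off even when [p x = 0] and [x] is not in [s]. *)
rewrite (@pairing_seq _ _ _ (x |` s)%fset); last first.
  by move=> y; rewrite in_fset1U negb_or => /andP[_ /ps].
rewrite (big_fsetD1 x) ?fset1U1 //= big_seq big1 ?addr0.
  by rewrite /delta eqxx mulr1.
by move=> y; rewrite in_fsetD1 => /andP[/negPf yx _]; rewrite /delta yx mulr0.
Qed.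

Lemma lambda_injective : injective (@lambda R X).
Proof.
move=> p q pq; apply/val_inj/funext => x.
by rewrite /= -!pairing_delta; exact: (congr1 (fun l : dual R X => l (delta x)) pq).
Qed.

Lemma finsupp_cutoff (s : {fset {classic X}}) (c : {classic X} -> R) :
  (fun x : {classic X} => if x \in s then c x else 0) \in
    @finitely_supported R X.
Proof.
apply/asboolP; apply: (@sub_finite_set {classic X} _ [set` s]) => // x /=.
by case: ifP => //; rewrite eqxx.
Qed.

Lemma dual_linear (phi : dual R X) : linear phi.
Proof. by have /asboolP[] := dualP phi. Qed.

HB.instance Definition _ (phi : dual R X) :=
  GRing.isLinear.Build R (power R X) R^o *:%R phi (dual_linear phi).

(** The truncation [h] of [f] to [s] agrees with [f] on [s], so [f - h] is killed by [phi]. *)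
Lemma linear_form_sum (phi : dual R X) (s : {fset {classic X}}) :
  (forall g : power R X, {in s, (0 : power R X) =1 g} -> phi g = 0) ->
  forall f : power R X, phi f = \sum_(x <- s) f x * phi (delta x).
Proof.
move=> phi0 f; pose h : power R X := \sum_(x <- s) f x *: delta x.
have hE (y : {classic X}) : h y = \sum_(x <- s) f x * delta x y.
  exact: (big_morph (fun g : power R X => g y : R)).
have -> : phi f = phi h.
  apply/eqP; rewrite -subr_eq0 -raddfB; apply/eqP/phi0 => y ys.
  rewrite [RHS](_ : _ = f y - h y) // hE (big_fsetD1 y) //= big_seq big1.
    by rewrite /delta eqxx mulr1 addr0 subrr.
  move=> x; rewrite in_fsetD1 => /andP[xy _].
  by rewrite /delta eq_sym (negPf xy) mulr0.
by rewrite linear_sum; apply: eq_bigr => x _; rewrite linearZ.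
Qed.

End Delta.

Lemma lambda_surjective (R : comPzRingType) (X : Type)
    (phi : dual (discrete_topology R) X) : exists p, lambda p = phi.
Proof.
have /asboolP[cphi _] := dualP phi.
have : nbhs (0 : power (discrete_topology R) X) [set g | phi g = 0].
  (* Discreteness enters here: the kernel is the preimage of the open set [[set 0]]. *)
  apply: (cphi 0 [set 0]).
  by rewrite raddf0 nbhs_principalE; apply/principal_filterP.
move=> /(@nbhs_ptws_discrete {classic X} (discrete_topology R))[s sphi].
exists (Finsupp (finsupp_cutoff s (fun x => phi (delta _ x)))).
apply/val_inj/funext => f /=.
rewrite (@pairing_seq _ _ _ s) /=; last by move=> x /negPf ->.
(* [big_seq] supplies [x \in s], under which the cut-off coefficient is [phi (delta x)]. *)
rewrite (linear_form_sum sphi) big_seq [RHS]big_seq.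
by apply: eq_bigr => x ->; rewrite mulrC.
Qed.

Theorem lemma18 (R : comPzRingType) : rigid (discrete_topology R).
Proof.
move=> X; have /choice[g gK] := @lambda_surjective R X.
(* The right inverse [g] obtained by choice is also a left inverse, by injectivity. *)
by exists g => // p; apply: lambda_injective; rewrite gK.
Qed.
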